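(* Let $K$ be a nonnegative function on $\mathbb{R}$ with $\int K(x)\,dx=1$, which is bounded, satisfies $\int x^2K(x)\,dx<+\infty$, and is monotone on some neighborhood of $-\infty$ and on some neighborhood of $+\infty$. For $w>0$ let $K_w(y)=w^{-1}K(w^{-1}y)$ and, given $X_1,\dots,X_n$ i.i.d. with density $s$ with respect to Lebesgue measure, let $\widehat{s}_w(x)=\frac1n\sum_{i=1}^nK_w(x-X_i)$. Assume $s$ is supported on an interval of length $2L$, and let $\phi$ be a nondecreasing concave function on $[0,+\infty)$ with $\phi(0)=0$ and $\omega_2(\sqrt{s},\eta)\le\phi(\eta)$ for all $\eta\ge0$, where \[ \omega_2(\sqrt{s},\eta)=\sup_{|z|\le\eta}\left\|\sqrt{s}(\cdot+z)-\sqrt{s}\right\|. \] Then there is a constant $C(K)$ depending only on $K$, equal to $1$ when $K$ is unimodal, such that for all $w>0$, \[ \mathbb{E}_s\left[h^2(\widehat{s}_w,s)\right]\le2\left[\int_{\mathbb{R}}(1\vee x^2)K(x)\,dx\right]\phi^2(w)+\frac{2L\|K\|_\infty}{nw}+\frac{C(K)}{n}. \]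
   Context: $\|\cdot\|$ denotes the $\mathbb{L}_2$-norm with respect to Lebesgue measure on $\mathbb{R}$. For densities $t,u$, $h^2(t,u)=\frac12\int(\sqrt{t}-\sqrt{u})^2\,dx$ is the squared Hellinger distance. *)

(* Defs.v *)
From HB Require Import structures.
From mathcomp Require Import all_boot all_order all_algebra.
From mathcomp Require Import all_classical all_reals all_analysis.
Set Implicit Arguments. Unset Strict Implicit. Unset Printing Implicit Defensive.
Import Order.TTheory GRing.Theory Num.Theory.
Import numFieldNormedType.Exports.
Local Open Scope classical_set_scope.
Local Open Scope ring_scope.

Section Defs.
Context {R : realType}.
Local Notation leb := (@lebesgue_measure R).

Definition Kw (K : R -> R) (w : R) (y : R) : R := w^-1 * K (w^-1 * y).

Definition kde (K : R -> R) (w : R) (n : nat) (X : seq R) (x : R) : R :=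
  n%:R^-1 * \sum_(Xi <- X) Kw K w (x - Xi).

Definition hellinger2 (t u : R -> R) : \bar R :=
  ((2:R)^-1)%:E * (\int[leb]_x ((Num.sqrt (t x) - Num.sqrt (u x)) ^+ 2)%:E)%E.

Definition omega2 (f : R -> R) (eta : R) : \bar R :=
  ereal_sup [set Lnorm leb 2%:E (fun x => (f (x + z) - f x)%:E) | z in [set z | `|z| <= eta]].

(** Expectation of F(X_1,..,X_n) for X_1,..,X_n i.i.d. with Lebesgue density s,
    written as the iterated integral against prod_i s(x_i) dx_i
    (equal to the product-measure integral by Tonelli for nonnegative F). *)
Fixpoint iid_expect (s : R -> R) (n : nat) (F : seq R -> \bar R) : \bar R :=
  match n with
  | 0%N => F [::]
  | n'.+1 => (\int[leb]_x ((s x)%:E * iid_expect s n' (fun xs => F (x :: xs))))%E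
  end.

Definition monotone_on (f : R -> R) (A : set R) : Prop :=
  {in A &, {homo f : x y / x <= y}} \/ {in A &, {homo f : x y / x <= y >-> y <= x}}.

Definition unimodal (K : R -> R) : Prop :=
  exists m : R, {in [set x | x <= m] &, {homo K : x y / x <= y}} /\
                {in [set x | m <= x] &, {homo K : x y / x <= y >-> y <= x}}.

Definition kernel_ok (K : R -> R) : Prop :=
  [/\ measurable_fun setT K,
      (forall x, 0 <= K x),
      (\int[leb]_x (K x)%:E = 1)%E,
      (exists M : R, forall x, K x <= M) &
      [/\ (\int[leb]_x (x ^+ 2 * K x)%:E < +oo)%E,
      (exists A : R, monotone_on K [set x | x <= A]) &
      (exists B : R, monotone_on K [set x | B <= x])]].

Definition density (s : R -> R) : Prop :=
  [/\ measurable_fun setT s, (forall x, 0 <= s x) & (\int[leb]_x (s x)%:E = 1)%E].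

End Defs.

(* Main.v *)
Require Import Defs.
From HB Require Import structures.
From mathcomp Require Import all_boot all_order all_algebra.
From mathcomp Require Import all_classical all_reals all_analysis.
From mathcomp Require Import measurable_realfun ring lra.
Set Implicit Arguments.
Unset Strict Implicit.
Unset Printing Implicit Defensive.
Import Order.TTheory GRing.Theory Num.Theory.
Import numFieldNormedType.Exports.
Local Open Scope classical_set_scope.
Local Open Scope ring_scope.

(** Let [sbar = K_w * s] be the mean of the estimator.  Since
    [(p - r)^2 / 2 <= (p - q)^2 + (q - r)^2], the risk splits into a variance
    and a bias part.

    Variance.  Pointwise, [(sqrt shat - sqrt sbar)^2 <= (shat - sbar)^2 / sbar],
    whose mean is at most [sup_y K_w(x - y) / n], with [y] ranging over the
    support [[a, a + 2L]] of [s].  If [K] is nondecreasing on [(-oo, A]] and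
    nonincreasing on [[B, +oo)], the supremum is attained at an end of the
    support unless [x] lies in an interval of length [2L + w (B - A)]; hence its
    integral is at most [|K| (2L/w + B - A) + 1].  This gives
    [C(K) = 1 + (B - A) |K|], which is [1] for a unimodal kernel, where [A = B].

    Bias.  [sqrt sbar (x)] is the L2(K)-norm of [u |-> sqrt s (x - w u)], so
    [(sqrt sbar - sqrt s)^2 (x) <= \int K(u) (sqrt s (x - w u) - sqrt s (x))^2 du].
    After integration in [x] this is at most [\int K(u) phi(w |u|)^2 du], and
    concavity yields [phi(w |u|) <= max(1, |u|) phi(w)]. *)

(** * Preliminaries on integrals of nonnegative functions *)

(** The integral of a nonnegative function is a supremum over the simple functions below it, so
    monotonicity needs no measurability. This allows comparing iterated expectations of arbitrary
    integrands. *)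
Lemma ge0_le_integral_nomeas d (T : measurableType d) (R : realType)
    (mu : {measure set T -> \bar R}) (f g : T -> \bar R) :
  (forall x, 0 <= f x)%E -> (forall x, f x <= g x)%E ->
  (\int[mu]_x f x <= \int[mu]_x g x)%E.
Proof.
move=> f0 fg; rewrite !ge0_integralTE//; last first.
  by move=> x; exact: le_trans (fg x).
by apply: le_ereal_sup => _ [h hf <-]; exists h => // x; exact: le_trans (fg x).
Qed.

Lemma ge0_integral_EFin d (T : measurableType d) (R : realType)
    (mu : {measure set T -> \bar R}) (f : T -> R) :
  measurable_fun setT f -> (forall x, 0 <= f x) ->
  (\int[mu]_x (f x)%:E < +oo)%E ->
  mu.-integrable setT (EFin \o f) /\
  exists2 r : R, 0 <= r & (\int[mu]_x (f x)%:E = r%:E)%E.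
Proof.
move=> mf f0 fi; split.
  apply/integrableP; split; first exact/measurable_EFinP.
  by under eq_integral do rewrite /= ger0_norm//.
have i0 : (0 <= \int[mu]_x (f x)%:E)%E.
  by apply: integral_ge0 => x _; rewrite lee_fin.
exists (fine (\int[mu]_x (f x)%:E)%E); first by rewrite fine_ge0.
by rewrite fineK// ge0_fin_numE.
Qed.

(** Lebesgue measure is [|c|] times its image under [x |-> c * x + e]: by uniqueness it suffices to
    compare the two on the intervals []a, b]]. *)
Lemma ge0_integral_affine (R : realType) (c e : R) (f : R -> \bar R) :
  c != 0 -> measurable_fun setT f -> (forall x, 0 <= f x)%E ->
  (\int[@lebesgue_measure R]_x f (c * x + e)%R =
   `|c|^-1%:E * \int[@lebesgue_measure R]_x f x)%E.
Proof.
move=> c0 mf f0.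
pose phi : R -> measurableTypeR R := fun x => c * x + e.
have mphi : measurable_fun setT phi.
  by apply: measurable_funD => //; exact: measurable_funM.
have cp : 0 < `|c| by rewrite normr_gt0.
pose k : {nonneg R} := NngNum (ltW cp).
have muE A : measurable A ->
    lebesgue_measure A = mscale k (pushforward (@lebesgue_measure R) phi) A.
  apply: lebesgue_measure_unique => //= _ [[a b]] _ <- /=.
  rewrite /mscale/= /pushforward.
  have [ab|ba] := ltP a b; last first.
    rewrite !set_itv_ge -?leNgt ?bnd_simp//.
    by rewrite preimage_set0 !measure0 mule0.
  (* For negative [c] the preimage is closed on the left instead of the right; its length is
     [(b - a) / |c|] either way. *)
  have -> : phi @^-1` `]a, b] = if 0 < c then `](a - e) / c, (b - e) / c]%classic
     else `[(b - e) / c, (a - e) / c[%classic.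
    apply/seteqP; rewrite /phi; split => x /=; rewrite in_itv/=.
      move=> /andP[ax xb]; case: ifPn => cc /=; rewrite in_itv/=.
        by rewrite ltr_pdivrMr// ler_pdivlMr//; apply/andP; split; lra.
      have {}cc : c < 0 by rewrite lt_neqAle c0 leNgt.
      by rewrite ler_ndivrMr// ltr_ndivlMr//; apply/andP; split; lra.
    case: ifPn => cc /=; rewrite in_itv/=.
      by rewrite ltr_pdivrMr// ler_pdivlMr// => /andP[? ?]; apply/andP; split; lra.
    have {}cc : c < 0 by rewrite lt_neqAle c0 leNgt.
    by rewrite ler_ndivrMr// ltr_ndivlMr// => /andP[? ?]; apply/andP; split; lra.
  rewrite (fun_if lebesgue_measure) !lebesgue_measure_itv/= !lte_fin ab.
  case: ifPn => cc /=.
    rewrite ltr_pM2r ?invr_gt0// ltrD2r ab (gtr0_norm cc) -!EFinB -EFinM.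
    by congr EFin; field.
  have {}cc : c < 0 by rewrite lt_neqAle c0 leNgt.
  rewrite ltr_nM2r ?invr_lt0// ltrD2r ab (ltr0_norm cc) -!EFinB -EFinM.
  by congr EFin; field.
have -> : (\int[@lebesgue_measure R]_x f x =
    `|c|%:E * \int[@lebesgue_measure R]_x f (c * x + e)%R)%E.
  rewrite (@eq_measure_integral _ _ _ setT
     (mscale k (pushforward (@lebesgue_measure R) phi))); last first.
    by move=> A mA _; exact: muE.
  rewrite ge0_integral_mscale//.
  by rewrite ge0_integral_pushforward// preimage_setT.
by rewrite muleA -EFinM mulVf ?gt_eqF// mul1e.
Qed.

(** * Iterated expectations: monotonicity, measurability and exchange with an integral *)

Section IidExpect.
Context (R : realType) (s : R -> R).
Hypotheses (ms : measurable_fun setT s) (s0 : forall x, 0 <= s x).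
Local Notation leb := (@lebesgue_measure R).
Local Open Scope ereal_scope.

Lemma iid_expect_ge0 n F : (forall X, 0 <= F X) -> 0 <= iid_expect s n F.
Proof.
elim: n F => [|n IH] F F0 //=; apply: integral_ge0 => x _.
by rewrite mule_ge0 ?lee_fin//; exact: IH.
Qed.

Lemma eq_iid_expect n F G : (forall X, size X = n -> F X = G X) ->
  iid_expect s n F = iid_expect s n G.
Proof.
elim: n F G => [|n IH] F G FG /=; first exact: FG.
by apply: eq_integral => x _; congr *%E; apply: IH => X Xn; apply: FG; rewrite /= Xn.
Qed.

Lemma le_iid_expect n F G : (forall X, 0 <= F X) ->
  (forall X, F X <= G X) -> iid_expect s n F <= iid_expect s n G.
Proof.
elim: n F G => [|n IH] F G F0 FG //=.
apply: ge0_le_integral_nomeas => x.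
  by rewrite mule_ge0 ?lee_fin//; exact: iid_expect_ge0.
by rewrite lee_wpmul2l ?lee_fin//; exact: IH.
Qed.

(** The integrand sees the sample only through a sum. Hence the first observation can be absorbed
    into the parameter, [T] becoming [T * R] and [h] being shifted by [k z], which is why the
    induction quantifies over [T], [h] and [k]. *)
Lemma measurable_iid_expect n d (T : measurableType d)
    (h : T * R -> \bar R) (k : T * R -> R) :
  measurable_fun setT h -> (forall z, 0 <= h z) -> measurable_fun setT k ->
  measurable_fun setT
    (fun t => iid_expect s n (fun X => h (t, \sum_(Xi <- X) k (t, Xi))%R)).
Proof.
elim: n d T h k => [|n IH] d T h k mh h0 mk /=.
  under eq_fun do rewrite big_nil.
  by apply: (measurableT_comp mh); exact: measurable_fun_pair.
pose f (z : T * R) := (s z.2)%:E * iid_expect s n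
   (fun X => h (z.1, k z + \sum_(Xi <- X) k (z.1, Xi))%R).
rewrite [X in measurable_fun _ X](_ : _ = fun t => \int[leb]_x f (t, x)); last first.
  apply/funext => t; apply: eq_integral => x _; congr *%E.
  by apply: eq_iid_expect => X _; rewrite big_cons.
apply: measurable_fun_fubini_tonelli_F; last first.
  by move=> z; rewrite mule_ge0 ?lee_fin//; exact: iid_expect_ge0.
apply: emeasurable_funM.
  by apply/measurable_EFinP; exact: measurableT_comp.
apply: (IH _ _ (fun z => h (z.1.1, k z.1 + z.2)%R) (fun z => k (z.1.1, z.2))).
- apply: (measurableT_comp mh); apply: measurable_fun_pair => /=.
    by apply: measurableT_comp => //; exact: measurable_fst.
  by apply: measurable_funD => //; apply: measurableT_comp.
- by move=> z.
- apply: (measurableT_comp mk); apply: measurable_fun_pair => //=.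
  by apply: measurableT_comp => //; exact: measurable_fst.
Qed.

(** Tonelli's theorem, one observation at a time; joint measurability comes from
    [measurable_iid_expect]. Once the integrals are swapped the first observation is fixed, so only
    [h] varies in the induction. *)
Lemma integral_iid_expect n d (T : measurableType d)
    (mu : {sigma_finite_measure set T -> \bar R})
    (h : T * R -> \bar R) (k : T * R -> R) :
  measurable_fun setT h -> (forall z, 0 <= h z) -> measurable_fun setT k ->
  \int[mu]_t iid_expect s n (fun X => h (t, \sum_(Xi <- X) k (t, Xi))%R) =
  iid_expect s n (fun X => \int[mu]_t h (t, \sum_(Xi <- X) k (t, Xi))%R).
Proof.
elim: n h => [|n IH] h mh h0 mk //=.
pose f (z : T * R) := (s z.2)%:E * iid_expect s n
   (fun X => h (z.1, k z + \sum_(Xi <- X) k (z.1, Xi))%R).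
have mI : measurable_fun setT (fun z : T * R => iid_expect s n
    (fun X => h (z.1, k z + \sum_(Xi <- X) k (z.1, Xi))%R)).
  apply: (@measurable_iid_expect n _ _
    (fun z => h (z.1.1, k z.1 + z.2)%R) (fun z => k (z.1.1, z.2))).
  - apply: (measurableT_comp mh); apply: measurable_fun_pair => /=.
      by apply: measurableT_comp => //; exact: measurable_fst.
    by apply: measurable_funD => //; apply: measurableT_comp.
  - by move=> z.
  - apply: (measurableT_comp mk); apply: measurable_fun_pair => //=.
    by apply: measurableT_comp => //; exact: measurable_fst.
have mf : measurable_fun setT f.
  by apply: emeasurable_funM => //; apply/measurable_EFinP; exact: measurableT_comp.
have f0 z : 0 <= f z.
  by rewrite mule_ge0 ?lee_fin//; exact: iid_expect_ge0.
transitivity (\int[mu]_t \int[leb]_x f (t, x)).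
  apply: eq_integral => t _; apply: eq_integral => x _; congr *%E.
  by apply: eq_iid_expect => X _; rewrite big_cons.
rewrite (@fubini_tonelli _ _ _ _ _ mu leb f mf f0); apply: eq_integral => x _.
rewrite /f/= ge0_integralZl//; last 3 first.
- have mt : measurable_fun setT (fun t : T => (t, x)).
    exact: measurable_fun_pair.
  exact: (measurableT_comp mI mt).
- by move=> t _; exact: iid_expect_ge0.
- by rewrite lee_fin.
congr *%E; rewrite (IH (fun z => h (z.1, k (z.1, x) + z.2)%R))//.
  apply: eq_iid_expect => X _; apply: eq_integral => t _.
  by rewrite big_cons.
apply: (measurableT_comp mh); apply: measurable_fun_pair => //=.
apply: measurable_funD => //; apply: (measurableT_comp mk).
by apply: measurable_fun_pair => //; exact: measurable_fst.
Qed.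

End IidExpect.

(** * Moments under a probability density *)

Section WeightedMoments.
Context (R : realType) (p u : R -> R) (m q : R).
Hypotheses (mp : measurable_fun setT p) (p0 : forall x, 0 <= p x).
Hypothesis (p1 : (\int[@lebesgue_measure R]_x (p x)%:E = 1)%E).
Hypotheses (mu : measurable_fun setT u) (u0 : forall x, 0 <= u x).
Hypothesis (pu : (\int[@lebesgue_measure R]_x (p x * u x)%:E = m%:E)%E).
Hypothesis (puu : (\int[@lebesgue_measure R]_x (p x * u x ^+ 2)%:E = q%:E)%E).

Lemma weighted_quadratic (a b c : R) :
  (\int[@lebesgue_measure R]_x (p x * (a + b * u x + c * u x ^+ 2))%:E =
   (a + b * m + c * q)%:E)%E.
Proof.
have mpu : measurable_fun setT (fun x => p x * u x) by exact: measurable_funM.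
have mpuu : measurable_fun setT (fun x => p x * u x ^+ 2).
  by apply: measurable_funM => //; exact: measurable_funX.
have [|ip _] := @ge0_integral_EFin _ _ _ (@lebesgue_measure R) p mp p0.
  by rewrite p1 ltry.
have [||ipu _] := @ge0_integral_EFin _ _ _ (@lebesgue_measure R) _ mpu.
- by move=> x; rewrite mulr_ge0.
- by rewrite pu ltry.
have [||ipuu _] := @ge0_integral_EFin _ _ _ (@lebesgue_measure R) _ mpuu.
- by move=> x; rewrite mulr_ge0// exprn_ge0.
- by rewrite puu ltry.
have E x : (p x * (a + b * u x + c * u x ^+ 2))%:E =
  (a%:E * (p x)%:E + b%:E * (p x * u x)%:E + c%:E * (p x * u x ^+ 2)%:E)%E.
  by rewrite -!EFinM -!EFinD; congr EFin; ring.
under eq_integral do rewrite E.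
have i1 := integrableZl measurableT a ip.
have i2 := integrableZl measurableT b ipu.
have i3 := integrableZl measurableT c ipuu.
have i12 := integrableD measurableT i1 i2.
rewrite (integralD measurableT i12 i3) (integralD measurableT i1 i2).
rewrite (integralZl measurableT ip) (integralZl measurableT ipu).
by rewrite (integralZl measurableT ipuu) p1 pu puu mule1 -!EFinM -!EFinD.
Qed.

(** The last bracket is the variance of the sum plus its squared mean. Integrating out one
    observation turns a quadratic in the sum into another quadratic with new coefficients, so the
    induction runs over all [a], [b], [c]. *)
Lemma iid_expect_quadratic n (a b c : R) :
  iid_expect p n (fun X => (a + b * \sum_(x <- X) u x
      + c * (\sum_(x <- X) u x) ^+ 2)%:E) =
  (a + b * (n%:R * m) + c * (n%:R * (q - m ^+ 2) + (n%:R * m) ^+ 2))%:E.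
Proof.
elim: n a b c => [|n IH] a b c /=.
  by rewrite big_nil; congr EFin; ring.
under eq_integral => x _.
  rewrite (_ : iid_expect _ _ _ = iid_expect p n (fun X =>
     ((a + b * u x + c * u x ^+ 2) + (b + 2 * c * u x) * \sum_(y <- X) u y
      + c * (\sum_(y <- X) u y) ^+ 2)%:E)); last first.
    by apply: eq_iid_expect => X _; rewrite big_cons; congr EFin; ring.
  rewrite IH -EFinM (_ : (a + b * u x + _ + _ + _) =
    (a + b * (n%:R * m) + c * (n%:R * (q - m ^+ 2) + (n%:R * m) ^+ 2))
    + (b + 2 * c * (n%:R * m)) * u x + c * u x ^+ 2); last by ring.
  over.
by rewrite weighted_quadratic; congr EFin; rewrite -addn1 natrD; ring.
Qed.

(** Expand the nonnegative integral of [p * (m - u) ^+ 2]. *)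
Lemma sqr_mean_le : m ^+ 2 <= q.
Proof.
have : (0 <= \int[@lebesgue_measure R]_x
    (p x * (m ^+ 2 + (- 2 * m) * u x + 1 * u x ^+ 2))%:E)%E.
  apply: integral_ge0 => x _; rewrite lee_fin mulr_ge0//.
  rewrite (_ : _ + _ = (m - u x) ^+ 2) ?sqr_ge0//; ring.
by rewrite weighted_quadratic lee_fin; nra.
Qed.

(* The right-hand side is [q - 2 r m + r ^ 2], and [m <= sqrt q] by Jensen. *)
Lemma sqr_sub_sqrt_le (r : R) : 0 <= r ->
  (((Num.sqrt q - r) ^+ 2)%:E <=
    \int[@lebesgue_measure R]_x (p x * (u x - r) ^+ 2)%:E)%E.
Proof.
move=> r0.
under eq_integral => x _.
  rewrite (_ : (u x - r) ^+ 2 = r ^+ 2 + (- 2 * r) * u x + 1 * u x ^+ 2).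
    over.
  by ring.
rewrite weighted_quadratic lee_fin.
have q0 : 0 <= q := le_trans (sqr_ge0 m) sqr_mean_le.
have mq : m <= Num.sqrt q.
  by rewrite (le_trans (ler_norm m))// -sqrtr_sqr ler_wsqrtr ?sqr_mean_le.
have := sqr_sqrtr q0; nra.
Qed.

End WeightedMoments.

(** * Rescaled kernels and monotone tails *)

Lemma integral_itv_cst (R : realType) (c a b : R) : 0 <= c -> a <= b ->
  (\int[@lebesgue_measure R]_x (c * \1_(`[a, b] : set R) x)%:E =
   (c * (b - a))%:E)%E.
Proof.
move=> c0 ab.
have E : @lebesgue_measure R ((`[a, b] : set R) `&` setT) = (b - a)%:E.
  rewrite setIT lebesgue_measure_itv/= lte_fin lt_neqAle ab andbT EFinB.
  by case: eqVneq => //= ->; rewrite subee.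
under eq_integral do rewrite EFinM.
rewrite ge0_integralZl_EFin//; last exact/measurable_EFinP.
rewrite EFinM -E; congr *%E; exact: integral_indic.
Qed.

Section Kernel.
Context (R : realType) (K : R -> R).
Local Notation leb := (@lebesgue_measure R).
Hypotheses (mK : measurable_fun setT K) (K0 : forall x, 0 <= K x).

Lemma Kw_affineE (w c x : R) : Kw K w (x - c) = w^-1 * K (w^-1 * x + - (w^-1 * c)).
Proof. by rewrite /Kw mulrBr. Qed.

Lemma Kw_ge0 (w x : R) : 0 < w -> 0 <= Kw K w x.
Proof. by move=> w0; rewrite /Kw mulr_ge0// invr_ge0 ltW. Qed.

Lemma measurable_Kw_sub (w : R) :
  measurable_fun setT (fun z : R * R => Kw K w (z.1 - z.2)).
Proof.
apply: measurable_funM => //; apply: (measurableT_comp mK).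
by apply: measurable_funM => //; apply: measurable_funB.
Qed.

Lemma integral_Kw (w c : R) : 0 < w ->
  (\int[leb]_x (Kw K w (x - c))%:E = \int[leb]_x (K x)%:E)%E.
Proof.
move=> w0; under eq_integral do rewrite Kw_affineE EFinM.
have mKE : measurable_fun setT (EFin \o K) by exact/measurable_EFinP.
rewrite ge0_integralZl_EFin//.
- rewrite (@ge0_integral_affine R w^-1 (- (w^-1 * c)) (EFin \o K))//.
  + rewrite gtr0_norm ?invr_gt0// invrK muleA -EFinM mulVf ?mul1e//.
    by rewrite gt_eqF.
  + by rewrite invr_eq0 gt_eqF.
- by move=> x _; rewrite lee_fin.
- have ma : measurable_fun setT (fun x : R => w^-1 * x + - (w^-1 * c)).
    by apply: measurable_funD => //; exact: measurable_funM.
  exact: (measurableT_comp mKE ma).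
- by rewrite invr_ge0 ltW.
Qed.

(** Substitute [y = x - w * u]; the Jacobian [w] cancels the factor [w^-1] of [Kw]. The scale moves
    from the kernel to the density, and [sbar] becomes a [K]-average of translates of [s]. *)
Lemma integral_Kw_convolution (s : R -> R) (w x : R) :
  measurable_fun setT s -> (forall y, 0 <= s y) -> 0 < w ->
  (\int[leb]_y (s y * Kw K w (x - y))%:E =
   \int[leb]_u (K u * s (- w * u + x))%:E)%E.
Proof.
move=> ms s0 w0; have w1 : w != 0 by rewrite gt_eqF.
pose f y := (w * (s y * Kw K w (x - y)))%:E.
have mg : measurable_fun setT (fun y => (s y * Kw K w (x - y))%:E).
  apply/measurable_EFinP; apply: measurable_funM => //.
  have mp : measurable_fun setT (fun y : R => (x, y)) by exact: measurable_fun_pair.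
  exact: (measurableT_comp (measurable_Kw_sub w) mp).
have g0 y : (0 <= (s y * Kw K w (x - y))%:E)%E.
  by rewrite lee_fin mulr_ge0// Kw_ge0.
have mf : measurable_fun setT f.
  rewrite (_ : f = fun y => (w%:E * (s y * Kw K w (x - y))%:E)%E)//.
  exact: emeasurable_funM.
have f0 y : (0 <= f y)%E by rewrite /f EFinM mule_ge0// lee_fin ltW.
have nw : - w != 0 by rewrite oppr_eq0.
have := @ge0_integral_affine R (- w) x f nw mf f0.
under [X in _ = (_ * X)%E]eq_integral do rewrite /f EFinM.
rewrite (@ge0_integralZl_EFin _ _ _ leb setT)//; last exact: ltW.
rewrite normrN gtr0_norm// muleA -EFinM mulVf// mul1e => <-.
apply: eq_integral => u _; rewrite /f; congr EFin.
rewrite /Kw opprD addrA addrAC subrr add0r mulNr opprK mulKf//.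
by rewrite mulrCA mulVKf// mulrC.
Qed.

Hypothesis K1 : (\int[leb]_x (K x)%:E = 1)%E.

(** Height [c] over length [2 / c] would already give mass 2. *)
Lemma density_not_bounded_below (c p : R) : 0 < c ->
  ~ (forall x, p <= x <= p + 2 / c -> c <= K x).
Proof.
move=> c0 cK; suff : (2%:E <= (1 : \bar R))%E by rewrite lee_fin; lra.
rewrite -K1; apply: (@le_trans _ _
    (\int[leb]_x (c * \1_(`[p, p + 2 / c] : set R) x)%:E)%E).
  rewrite integral_itv_cst ?(ltW c0)//; last by rewrite lerDl divr_ge0// ltW.
  by rewrite lee_fin addrAC subrr add0r mulrC divfK ?gt_eqF.
apply: ge0_le_integral_nomeas => x.
  by rewrite lee_fin mulr_ge0// ltW.
rewrite lee_fin indicE; case: (boolP (x \in _)) => [|_]; last by rewrite mulr0.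
by rewrite inE/= in_itv/= => h; rewrite mulr1; exact: cK.
Qed.

(* A nonincreasing left tail of an integrable nonnegative function vanishes. *)
Lemma monotone_on_Ny (A : R) : monotone_on K [set x | x <= A] ->
  forall x y, x <= y -> y <= A -> K x <= K y.
Proof.
move=> [H|H] x y xy yA.
  by apply: H => //; rewrite inE/=; lra.
suff -> : K x = 0 by [].
apply/eqP; rewrite eq_le K0 andbT leNgt; apply/negP => Kx.
(* [K] would stay above [K x] on the interval of length [2 / K x] ending at [x]. *)
apply: (@density_not_bounded_below (K x) (x - 2 / K x)) => // z /andP[_ zx].
by apply: H; rewrite ?inE/=; lra.
Qed.

(** Mirror image of the left tail: if the right tail is nondecreasing, a positive value at [y] would
    persist on [[y, y + 2 / K y]]. *)
Lemma monotone_on_y (B : R) : monotone_on K [set x | B <= x] ->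
  forall x y, B <= x -> x <= y -> K y <= K x.
Proof.
move=> [H|H] x y Bx xy; last by apply: H => //; rewrite inE/=; lra.
suff -> : K y = 0 by [].
apply/eqP; rewrite eq_le K0 andbT leNgt; apply/negP => Ky.
apply: (@density_not_bounded_below (K y) y) => // z /andP[yz _].
by apply: H; rewrite ?inE/=; lra.
Qed.

End Kernel.

Lemma kernel_tails (R : realType) (K : R -> R) : kernel_ok K ->
  exists A B, [/\ A <= B, (unimodal K -> A = B),
    (forall x y, x <= y -> y <= A -> K x <= K y) &
    (forall x y, B <= x -> x <= y -> K y <= K x)].
Proof.
move=> [mK K0 K1 _ [_ [A HA] [B HB]]].
have [[m [H1 H2]]|nu] := pselect (unimodal K).
  (* Both thresholds are the mode, so that [B - A = 0] and the final constant is 1. *)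
  exists m, m; split => // x y ? ?; [apply: H1|apply: H2]; rewrite ?inE//=; lra.
(* Lowering the left threshold keeps the tail monotone and puts the thresholds in order. *)
exists (Num.min A B), B; split => //; first by rewrite ge_min lexx orbT.
- move=> x y xy; rewrite le_min => /andP[yA _].
  exact: (monotone_on_Ny K0 K1 HA).
- by move=> x y; exact: (monotone_on_y K0 K1 HB).
Qed.

(** * An integrable envelope for the translates of the kernel *)

Section Envelope.
Context (R : realType) (K : R -> R) (A B lo hi w M : R).
Local Notation leb := (@lebesgue_measure R).
Hypotheses (mK : measurable_fun setT K) (K0 : forall x, 0 <= K x).
Hypotheses (KM : forall x, K x <= M) (w0 : 0 < w) (AB : A <= B) (lohi : lo <= hi).
Hypothesis (KA : forall x y, x <= y -> y <= A -> K x <= K y).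
Hypothesis (KB : forall x y, B <= x -> x <= y -> K y <= K x).

(** The half-lines are open so that the two tails are disjoint even when [A = B]; their masses then
    add up to at most 1. *)
Let KL (u : R) := K u * \1_(`]-oo, A[ : set R) u.
Let KR (u : R) := K u * \1_(`]B, +oo[ : set R) u.

(* Dominates [y |-> Kw K w (x - y)] on [[lo, hi]]: the tails of [K], moved to the
   two ends of the interval, plus the crude bound [M / w] in between. *)
Definition envelope (x : R) : R :=
  M / w * \1_(`[lo + w * A, hi + w * B] : set R) x +
  Kw KL w (x - lo) + Kw KR w (x - hi).

Let M0 : 0 <= M. Proof. exact: le_trans (K0 0) (KM 0). Qed.

Let KL0 u : 0 <= KL u. Proof. exact: mulr_ge0. Qed.
Let KR0 u : 0 <= KR u. Proof. exact: mulr_ge0. Qed.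

Let mKL : measurable_fun setT KL. Proof. exact: measurable_funM. Qed.
Let mKR : measurable_fun setT KR. Proof. exact: measurable_funM. Qed.

Let mKwL : measurable_fun setT (fun x : R => (Kw KL w (x - lo))%:E).
Proof.
have mp : measurable_fun setT (fun x : R => (x, lo)) by exact: measurable_fun_pair.
apply/measurable_EFinP.
exact: (measurableT_comp (measurable_Kw_sub mKL w) mp).
Qed.

Let mKwR : measurable_fun setT (fun x : R => (Kw KR w (x - hi))%:E).
Proof.
have mp : measurable_fun setT (fun x : R => (x, hi)) by exact: measurable_fun_pair.
apply/measurable_EFinP.
exact: (measurableT_comp (measurable_Kw_sub mKR w) mp).
Qed.

Let mI : measurable_fun setT (fun x : R =>
  (M / w * \1_(`[lo + w * A, hi + w * B] : set R) x)%:E).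
Proof. by apply/measurable_EFinP; exact: measurable_funM. Qed.

Let I0 (x : R) : 0 <= M / w * \1_(`[lo + w * A, hi + w * B] : set R) x.
Proof. by rewrite mulr_ge0// divr_ge0// ltW. Qed.

Lemma envelope_ge0 x : 0 <= envelope x.
Proof. by rewrite !addr_ge0// Kw_ge0. Qed.

Lemma measurable_envelope : measurable_fun setT envelope.
Proof.
by apply: measurable_funD; [apply: measurable_funD|]; exact/measurable_EFinP.
Qed.

(** If [x - lo < w * A], every [x - y] lies in the increasing tail and [y = lo] is the worst case;
    symmetrically, [y = hi] is the worst case if [x - hi > w * B]. *)
Lemma Kw_le_envelope x y : lo <= y <= hi -> Kw K w (x - y) <= envelope x.
Proof.
move=> /andP[ly yh].
have wi : 0 < w^-1 by rewrite invr_gt0.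
have [xA|xA] := ltP (w^-1 * (x - lo)) A.
  apply: (@le_trans _ _ (Kw KL w (x - lo))); last first.
    by rewrite /envelope addrAC ler_wpDl// addr_ge0// Kw_ge0.
  rewrite /Kw /KL indicE mem_set ?mulr1//=.
  rewrite ler_pM2l//; apply: KA; last exact: ltW.
  by rewrite ler_pM2l// lerD2l lerN2.
have [xB|xB] := ltP B (w^-1 * (x - hi)).
  apply: (@le_trans _ _ (Kw KR w (x - hi))); last first.
    by rewrite /envelope ler_wpDl// addr_ge0// Kw_ge0.
  rewrite /Kw /KR indicE mem_set ?mulr1//=; last by rewrite in_itv/= andbT.
  rewrite ler_pM2l//; apply: KB; first exact: ltW.
  by rewrite ler_pM2l// lerD2l lerN2.
(* The remaining [x] fill exactly [[lo + w * A, hi + w * B]]. *)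
apply: (@le_trans _ _ (M / w)).
  by rewrite /Kw mulrC ler_pM2r.
rewrite /envelope -addrA ler_wpDr ?addr_ge0 ?Kw_ge0//.
rewrite indicE mem_set ?mulr1//= in_itv/=.
move: xA xB; rewrite ler_pdivlMl// ler_pdivrMl//; lra.
Qed.

(** The middle interval has length [hi - lo + w * (B - A)], and its height [M / w] turns the second
    summand into [M * (B - A)], free of [w]. Rescaling preserves the mass of the tails, which
    contribute at most 1. *)
Lemma integral_envelope : (\int[leb]_x (K x)%:E = 1)%E ->
  (\int[leb]_x (envelope x)%:E <= (M / w * (hi - lo) + M * (B - A) + 1)%:E)%E.
Proof.
move=> K1; rewrite /envelope; under eq_integral do rewrite !EFinD.
have KwE0 f : (forall x, 0 <= f x) -> forall x : R, (0 <= (Kw f w x)%:E)%E.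
  by move=> f0 x; rewrite lee_fin Kw_ge0.
rewrite ge0_integralD//; last 3 first.
- by move=> x _; rewrite adde_ge0// ?KwE0// lee_fin.
- exact: emeasurable_funD.
- by move=> x _; exact: KwE0.
rewrite ge0_integralD//; last 2 first.
- by move=> x _; rewrite lee_fin.
- by move=> x _; exact: KwE0.
have LR : (\int[leb]_x (KL x)%:E + \int[leb]_x (KR x)%:E <= 1)%E.
  rewrite -ge0_integralD//; last 4 first.
  - by move=> x _; rewrite lee_fin.
  - exact/measurable_EFinP.
  - by move=> x _; rewrite lee_fin.
  - exact/measurable_EFinP.
  rewrite -K1; apply: ge0_le_integral_nomeas => u.
    by rewrite adde_ge0// lee_fin.
  rewrite -EFinD lee_fin -mulrDr ler_piMr// !indicE.
  have b1 (b : bool) : b%:R <= 1 :> R by case: b.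
  have [uA|uA] := boolP (u \in `]-oo, A[%classic); last first.
    by rewrite add0r; exact: b1.
  rewrite memNset ?addr0 /=; first by [].
  by move: uA; rewrite inE/= !in_itv/= andbT => /ltW uA;
    rewrite ltNge (le_trans uA AB).
rewrite !integral_Kw// -addeA EFinD; apply: leeD LR.
have wAB : lo + w * A <= hi + w * B by rewrite lerD// ler_pM2l.
rewrite integral_itv_cst//; last by rewrite divr_ge0// ltW.
rewrite lee_fin le_eqVlt; apply/orP; left; apply/eqP.
by field; rewrite gt_eqF.
Qed.

End Envelope.

(** * Risk of the estimator at a fixed point *)

Lemma measurable_sqrtr (R : realType) : measurable_fun setT (fun x : R => Num.sqrt x).
Proof. by apply: continuous_measurable_fun; exact: sqrt_continuous. Qed.

Section PointwiseRisk.
Context (R : realType) (s k : R -> R) (m M : R).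
Local Notation leb := (@lebesgue_measure R).
Hypotheses (ms : measurable_fun setT s) (s0 : forall y, 0 <= s y).
Hypothesis (s1 : (\int[leb]_y (s y)%:E = 1)%E).
Hypotheses (mk : measurable_fun setT k) (k0 : forall y, 0 <= k y).
Hypothesis (sk : (\int[leb]_y (s y * k y)%:E = m%:E)%E).
Hypotheses (M0 : 0 <= M) (skM : forall y, s y != 0 -> k y <= M).

(** Where [s] vanishes both integrands do, so a bound on [k] over the support of [s] gives
    [s k^2 <= M s k] everywhere. *)
Lemma bounded_second_moment : exists2 q : R, q <= M * m &
  (\int[leb]_y (s y * k y ^+ 2)%:E = q%:E)%E.
Proof.
have msk : measurable_fun setT (fun y => s y * k y) by exact: measurable_funM.
have msk2 : measurable_fun setT (fun y => s y * k y ^+ 2).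
  by apply: measurable_funM => //; exact: measurable_funX.
have sk0 y : 0 <= s y * k y by exact: mulr_ge0.
have sk20 y : 0 <= s y * k y ^+ 2 by rewrite mulr_ge0// exprn_ge0.
have le : (\int[leb]_y (s y * k y ^+ 2)%:E <= (M * m)%:E)%E.
  rewrite EFinM -sk -ge0_integralZl_EFin//; last 2 first.
  - by move=> y _; rewrite lee_fin.
  - exact/measurable_EFinP.
  apply: ge0_le_integral_nomeas => y; first by rewrite lee_fin.
  rewrite -EFinM lee_fin; have [->|sy] := eqVneq (s y) 0.
    by rewrite !mul0r mulr0.
  by rewrite [leRHS]mulrCA ler_wpM2l// expr2 ler_wpM2r// skM.
have [_ [q _ qE]] := @ge0_integral_EFin _ _ _ leb _ msk2 sk20 (le_lt_trans le (ltry _)).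
by exists q => //; rewrite -lee_fin -qE.
Qed.

(* If [m = 0], then [k] vanishes almost surely and the crude bound by
   [n^-1 \sum k + r] is exact; otherwise divide by [m]. *)
Lemma pointwise_risk (n : nat) (r : R) : (0 < n)%N -> 0 <= r ->
  (iid_expect s n (fun X =>
     (2^-1 * (Num.sqrt (n%:R^-1 * \sum_(x <- X) k x) - Num.sqrt r) ^+ 2)%:E) <=
   ((Num.sqrt m - Num.sqrt r) ^+ 2 + M / n%:R)%:E)%E.
Proof.
move=> n0 r0; have [q qM skk] := bounded_second_moment.
have n0' : 0 < n%:R :> R by rewrite ltr0n.
have m0 : 0 <= m.
  rewrite -lee_fin -sk; apply: integral_ge0 => y _.
  by rewrite lee_fin mulr_ge0.
have S0 X : 0 <= n%:R^-1 * \sum_(x <- X) k x.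
  by rewrite mulr_ge0 ?invr_ge0 ?(ltW n0')//; exact: sumr_ge0.
have half0 (z : R) : (0 <= (2^-1 * z ^+ 2)%:E)%E.
  by rewrite lee_fin mulr_ge0 ?sqr_ge0// invr_ge0.
move: m0; rewrite le_eqVlt => /orP[/eqP m0|m0].
  rewrite -m0 sqrtr0 sub0r sqrrN sqr_sqrtr//.
  apply: (@le_trans _ _ (iid_expect s n (fun X => (r + n%:R^-1 *
      \sum_(x <- X) k x + 0 * (\sum_(x <- X) k x) ^+ 2)%:E))).
    apply: le_iid_expect => // X; rewrite lee_fin mul0r addr0.
    set S := n%:R^-1 * _.
    have := sqr_sqrtr (S0 X); have := sqr_sqrtr r0; rewrite -/S.
    have := sqrtr_ge0 S; have := sqrtr_ge0 r; nra.
  rewrite (iid_expect_quadratic ms s0 s1 mk k0 sk skk) lee_fin -m0.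
  by rewrite !mulr0 mul0r !addr0 lerDl divr_ge0// ltW.
set b := (Num.sqrt m - Num.sqrt r) ^+ 2.
(* These coefficients expand [b + (S - m)^2 / m], with [S] the sample mean of [k], as a quadratic in
   the sum, whose expectation is explicit. *)
apply: (@le_trans _ _ (iid_expect s n (fun X => ((b + m) +
   (- 2 / n%:R) * \sum_(x <- X) k x +
   (n%:R ^+ 2 * m)^-1 * (\sum_(x <- X) k x) ^+ 2)%:E))).
  apply: le_iid_expect => // X; rewrite lee_fin.
  rewrite (_ : b + m + _ + _ =
      b + (n%:R^-1 * (\sum_(x <- X) k x) - m) ^+ 2 / m); last first.
    by field; rewrite !gt_eqF.
  set S := n%:R^-1 * _.
  have SS : S = Num.sqrt S ^+ 2 by exact/esym/sqr_sqrtr/S0.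
  have mm : m = Num.sqrt m ^+ 2 by rewrite sqr_sqrtr// ltW.
  have a0 := sqrtr_ge0 S; have b0 : 0 < Num.sqrt m by rewrite sqrtr_gt0.
  move: (Num.sqrt S) (Num.sqrt m) (Num.sqrt r) SS mm a0 b0 @b
    => x y z SS mm x0 y0 b.
  apply: (@le_trans _ _ (b + (x - y) ^+ 2)).
    by rewrite /b; have := sqr_ge0 (x - y - (y - z)); nra.
  rewrite lerD2l ler_pdivlMr// SS mm.
  (* After removing the common factor [(x - y)^2], only [y <= x + y] remains. *)
  rewrite (_ : x ^+ 2 - y ^+ 2 = (x - y) * (x + y)); last by ring.
  rewrite exprMn ler_wpM2l ?sqr_ge0// ler_sqr ?nnegrE; lra.
rewrite (iid_expect_quadratic ms s0 s1 mk k0 sk skk) lee_fin.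
(* The unbiased linear part cancels, leaving variance over [n * m]; [q <= M * m] bounds it by
   [M / n]. *)
rewrite (_ : b + m + _ + _ = b + (q - m ^+ 2) / m / n%:R); last first.
  by field; rewrite !gt_eqF.
rewrite lerD2l ler_pM2r ?invr_gt0// ler_pdivrMr//.
have := sqr_ge0 m; lra.
Qed.

End PointwiseRisk.

(** * Bias: translations of the root density *)

Section Bias.
Context (R : realType) (K s : R -> R) (phi : R -> R) (w : R).
Local Notation leb := (@lebesgue_measure R).
Hypotheses (mK : measurable_fun setT K) (K0 : forall x, 0 <= K x).
Hypothesis (K1 : (\int[leb]_x (K x)%:E = 1)%E).
Hypotheses (ms : measurable_fun setT s) (s0 : forall x, 0 <= s x).
Hypothesis (phi_nd : {in [set x : R | 0 <= x] &, {homo phi : x y / x <= y}}).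
Hypothesis (phi_concave : forall x y t, 0 <= x -> 0 <= y -> 0 <= t <= 1 ->
  t * phi x + (1 - t) * phi y <= phi (t * x + (1 - t) * y)).
Hypothesis (phi0 : phi 0 = 0).
Hypothesis (omega_phi : forall eta, 0 <= eta ->
  (omega2 (fun x => Num.sqrt (s x)) eta <= (phi eta)%:E)%E).
Hypothesis (w0 : 0 < w).

Lemma modulus_ge0 x : 0 <= x -> 0 <= phi x.
Proof. by move=> x0; rewrite -phi0 phi_nd// inE/=. Qed.

Lemma modulus_dilation_le u :
  phi (w * `|u|) ^+ 2 <= Num.max 1 (u ^+ 2) * phi w ^+ 2.
Proof.
have pw := modulus_ge0 (ltW w0).
have wu0 : 0 <= w * `|u| by rewrite mulr_ge0// ltW.
have pwu := modulus_ge0 wu0.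
have [u1|u1] := leP `|u| 1.
  apply: (@le_trans _ _ (1 * phi w ^+ 2)).
    rewrite mul1r ler_sqr ?nnegrE// phi_nd ?inE//=; first exact: ltW.
    by rewrite ler_piMr// ltW.
  by rewrite ler_wpM2r ?sqr_ge0// le_max lexx.
have u0 : 0 < `|u| by exact: lt_trans u1.
have H : phi (w * `|u|) <= `|u| * phi w.
  (* Concavity between [w * |u|] and 0, with weight [1 / |u|] on the former: the combination is
     [w]. *)
  have t01 : 0 <= `|u|^-1 <= 1 by rewrite invr_ge0 ltW//= invf_le1// ltW.
  have := phi_concave wu0 (lexx 0) t01.
  rewrite phi0 !mulr0 !addr0 mulrCA mulVf ?gt_eqF// mulr1.
  by rewrite ler_pdivrMl.
apply: (@le_trans _ _ (u ^+ 2 * phi w ^+ 2)).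
  by rewrite -(real_normK (num_real u)) -exprMn ler_sqr ?nnegrE// mulr_ge0.
by rewrite ler_wpM2r ?sqr_ge0// le_max lexx orbT.
Qed.

(** The shift [z] itself competes in the supremum defining [omega2] at [|z|]. *)
Lemma sqr_translation_le (z : R) :
  (\int[leb]_x ((Num.sqrt (s (x + z)) - Num.sqrt (s x)) ^+ 2)%:E
    <= (phi `|z| ^+ 2)%:E)%E.
Proof.
pose f x := (Num.sqrt (s (x + z)) - Num.sqrt (s x))%:E.
have N : (Lnorm leb 2%:E f <= (phi `|z|)%:E)%E.
  apply: le_trans (omega_phi (normr_ge0 z)).
  by apply: ereal_sup_ubound; exists z => //=.
have -> : (\int[leb]_x ((Num.sqrt (s (x + z)) - Num.sqrt (s x)) ^+ 2)%:E =
    Lnorm leb 2%:E f `^ 2)%E.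
  rewrite poweR_Lnorm//; apply: eq_integral => x _.
  by rewrite /= powR_mulrn// real_normK// num_real.
have -> : ((phi `|z| ^+ 2)%:E = (phi `|z|)%:E `^ 2)%E.
  by rewrite poweR_EFin powR_mulrn// modulus_ge0.
apply: gt0_ler_poweR => //; rewrite in_itv/= leey andbT.
  exact: Lnorm_ge0.
by rewrite lee_fin modulus_ge0.
Qed.

Lemma bias_le (sbar : R -> R) :
  (forall x, (\int[leb]_u (K u * s (- w * u + x))%:E = (sbar x)%:E)%E) ->
  (\int[leb]_x ((Num.sqrt (sbar x) - Num.sqrt (s x)) ^+ 2)%:E <=
    (\int[leb]_x (Num.max 1 (x ^+ 2) * K x)%:E) * (phi w ^+ 2)%:E)%E.
Proof.
move=> sbarE.
have mr : measurable_fun setT (fun x : R => Num.sqrt (s x)).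
  exact: (measurableT_comp (@measurable_sqrtr R) ms).
have m1 : measurable_fun setT (fun z : R * R => z.1) by exact: measurable_fst.
have mshift : measurable_fun setT (fun z : R * R => - w * z.2 + z.1).
  by apply: measurable_funD => //; exact: measurable_funM.
pose f (z : R * R) :=
  (K z.2 * (Num.sqrt (s (- w * z.2 + z.1)) - Num.sqrt (s z.1)) ^+ 2)%:E.
have mf : measurable_fun setT f.
  apply/measurable_EFinP; apply: measurable_funM; first exact: measurableT_comp.
  apply: measurable_funX; apply: measurable_funB.
    exact: (measurableT_comp mr mshift).
  exact: (measurableT_comp mr m1).
have f0 z : (0 <= f z)%E by rewrite lee_fin mulr_ge0// sqr_ge0.
apply: (@le_trans _ _ (\int[leb]_x \int[leb]_u f (x, u))%E).
  apply: ge0_le_integral_nomeas => x; first by rewrite lee_fin sqr_ge0.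
  pose v u := Num.sqrt (s (- w * u + x)).
  have mu : measurable_fun setT v.
    have mp : measurable_fun setT (fun u : R => (x, u)).
      exact: measurable_fun_pair.
    exact: (measurableT_comp (measurableT_comp mr mshift) mp).
  have v0 u : 0 <= v u by exact: sqrtr_ge0.
  have Kvv : (\int[leb]_u (K u * v u ^+ 2)%:E = (sbar x)%:E)%E.
    by rewrite -sbarE; apply: eq_integral => u _; rewrite /v sqr_sqrtr.
  have mKv : measurable_fun setT (fun u => K u * v u) by exact: measurable_funM.
  have mKvv : measurable_fun setT (fun u => K u * v u ^+ 2).
    by apply: measurable_funM => //; exact: measurable_funX.
  have Kv0 u : 0 <= K u * v u by exact: mulr_ge0.
  (* The first moment is finite because [v <= 1 + v^2] and [K] has mass 1. *)
  have Kvlty : (\int[leb]_u (K u * v u)%:E < +oo)%E.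
    apply: (@le_lt_trans _ _ (1 + (sbar x)%:E)%E); last by rewrite -EFinD ltry.
    rewrite -Kvv -K1 -ge0_integralD//; last 4 first.
    - by move=> u _; rewrite lee_fin.
    - exact/measurable_EFinP.
    - by move=> u _; rewrite lee_fin mulr_ge0// sqr_ge0.
    - exact/measurable_EFinP.
    apply: ge0_le_integral_nomeas => u; first by rewrite lee_fin.
    rewrite -EFinD lee_fin -{2}(mulr1 (K u)) -mulrDr ler_wpM2l//.
    have := sqr_ge0 (v u - 2^-1); nra.
  have [_ [m _ Kv]] := @ge0_integral_EFin _ _ _ leb _ mKv Kv0 Kvlty.
  exact: (sqr_sub_sqrt_le mK K0 K1 mu v0 Kv Kvv (sqrtr_ge0 (s x))).
(* With [u] frozen, the inner integral in [x] is the squared norm of a translation increment with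
   shift [- w * u]. *)
rewrite (@fubini_tonelli _ _ _ _ _ leb leb f mf f0).
rewrite muleC -ge0_integralZl_EFin ?sqr_ge0//; last 2 first.
- by move=> x _; rewrite lee_fin mulr_ge0// le_max ler01.
- apply/measurable_EFinP; apply: measurable_funM => //.
  by apply: measurable_maxr => //; exact: measurable_funX.
apply: ge0_le_integral_nomeas => u.
  by apply: integral_ge0 => x _.
rewrite /f/=; under eq_integral do rewrite EFinM.
rewrite ge0_integralZl_EFin//; last 2 first.
- by move=> x _; rewrite lee_fin sqr_ge0.
- have mp : measurable_fun setT (fun x : R => (x, u)).
    exact: measurable_fun_pair.
  apply/measurable_EFinP; apply: measurable_funX; apply: measurable_funB => //.
  exact: (measurableT_comp (measurableT_comp mr mshift) mp).
apply: (@le_trans _ _ ((K u)%:E * (phi (w * `|u|) ^+ 2)%:E)%E).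
  rewrite lee_wpmul2l ?lee_fin//.
  have := sqr_translation_le (- w * u).
  rewrite normrM normrN (gtr0_norm w0); apply: le_trans.
  by rewrite le_eqVlt; apply/orP; left; apply/eqP; apply: eq_integral => x _;
    rewrite (addrC (- w * u)).
rewrite -!EFinM lee_fin.
by rewrite mulrC [leRHS]mulrA ler_wpM2r// [leRHS]mulrC modulus_dilation_le.
Qed.

End Bias.

(** * Assembling variance and bias *)

Local Notation leb := lebesgue_measure.

Lemma hellinger2_kde_le (R : realType) (K s : R -> R) (A B a L M w : R)
    (phi : R -> R) (n : nat) :
  measurable_fun setT K -> (forall x, 0 <= K x) ->
  (\int[@lebesgue_measure R]_x (K x)%:E = 1)%E ->
  (forall x, K x <= M) -> A <= B ->
  (forall x y, x <= y -> y <= A -> K x <= K y) ->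
  (forall x y, B <= x -> x <= y -> K y <= K x) ->
  (0 < n)%N -> density s ->
  (forall x, ~ (a <= x <= a + 2 * L) -> s x = 0) ->
  {in [set x : R | 0 <= x] &, {homo phi : x y / x <= y}} ->
  (forall x y t, 0 <= x -> 0 <= y -> 0 <= t <= 1 ->
     t * phi x + (1 - t) * phi y <= phi (t * x + (1 - t) * y)) ->
  phi 0 = 0 ->
  (forall eta, 0 <= eta ->
     (omega2 (fun x => Num.sqrt (s x)) eta <= (phi eta)%:E)%E) ->
  0 < w ->
  (iid_expect s n (fun X => hellinger2 (kde K w n X) s)
    <= (\int[@lebesgue_measure R]_x (Num.max 1 (x ^+ 2) * K x)%:E)
         * (phi w ^+ 2)%:E
       + ((M / w * (2 * L) + M * (B - A) + 1) / n%:R)%:E)%E.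
Proof.
move=> mK K0 K1 KM AB KA KB n0 [ms s0 s1] supp phi_nd phi_cc phi0 om w0.
have n0' : 0 < n%:R :> R by rewrite ltr0n.
(* The sign of [L] comes from the mass of [s]: an empty support interval would force mass 0. *)
have L0 : a <= a + 2 * L.
  rewrite leNgt; apply/negP => aL.
  suff : (1 : \bar R)%E = 0%E by move/eqP; rewrite onee_eq0.
  rewrite -s1 integral0_eq// => x _; congr EFin.
  by apply: supp => /andP[ax xa]; move: aL; rewrite ltNge (le_trans ax xa).
have m1 : measurable_fun setT (fun z : R * R => z.1) by exact: measurable_fst.
have m2 : measurable_fun setT (fun z : R * R => z.2) by exact: measurable_snd.
have mKw2 := measurable_Kw_sub mK w.
have Kw0 x : 0 <= Kw K w x by exact: Kw_ge0.
have mKw x : measurable_fun setT (fun y : R => Kw K w (x - y)).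
  have mp : measurable_fun setT (fun y : R => (x, y)) by exact: measurable_fun_pair.
  exact: (measurableT_comp mKw2 mp).
have M0 : 0 <= M := le_trans (K0 0) (KM 0).
have KwM x : Kw K w x <= M / w.
  by rewrite /Kw mulrC ler_pM2r// invr_gt0.
have sKw0 x y : 0 <= s y * Kw K w (x - y) by exact: mulr_ge0.
have msKw x : measurable_fun setT (fun y : R => s y * Kw K w (x - y)).
  exact: measurable_funM.
(* Boundedness of [K] makes the mean of the estimator finite at every point, so [sbar] can be chosen
   real-valued. *)
have sbarP x : exists r : R, (\int[leb]_y (s y * Kw K w (x - y))%:E = r%:E)%E.
  have lty : (\int[leb]_y (s y * Kw K w (x - y))%:E < +oo)%E.
    apply: (@le_lt_trans _ _ (\int[leb]_y ((M / w)%:E * (s y)%:E))%E).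
      apply: ge0_le_integral_nomeas => y; first by rewrite lee_fin.
      by rewrite -EFinM lee_fin mulrC ler_wpM2r.
    rewrite ge0_integralZl_EFin//; last 3 first.
    - by move=> y _; rewrite lee_fin.
    - exact/measurable_EFinP.
    - by rewrite divr_ge0// ltW.
    by rewrite s1 mule1 ltry.
  have [_ [r _ rE]] := @ge0_integral_EFin _ _ _ (@leb R) _ (msKw x) (sKw0 x) lty.
  by exists r.
have [sbar sbarE] := choice sbarP.
pose env := envelope K A B a (a + 2 * L) w M.
have env0 x : 0 <= env x by exact: envelope_ge0.
have menv : measurable_fun setT env by exact: measurable_envelope.
pose h (z : R * R) :=
  (2^-1 * (Num.sqrt (n%:R^-1 * z.2) - Num.sqrt (s z.1)) ^+ 2)%:E.
have msq := @measurable_sqrtr R.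
have mr := measurableT_comp msq ms.
have mh : measurable_fun setT h.
  apply/measurable_EFinP; apply: measurable_funM => //.
  apply: measurable_funX; apply: measurable_funB.
    have mn : measurable_fun setT (fun z : R * R => n%:R^-1 * z.2).
      exact: measurable_funM.
    exact: (measurableT_comp msq mn).
  exact: (measurableT_comp mr m1).
have h0 z : (0 <= h z)%E.
  by rewrite lee_fin mulr_ge0 ?sqr_ge0// invr_ge0.
(* The Hellinger integrand is written as a function of [x] and a sum over the sample, the form in
   which expectation and integral can be exchanged. *)
have -> : iid_expect s n (fun X => hellinger2 (kde K w n X) s) =
    iid_expect s n (fun X =>
      \int[leb]_x h (x, \sum_(Xi <- X) Kw K w ((x, Xi).1 - (x, Xi).2))%R)%E.
  apply: eq_iid_expect => X _; rewrite /hellinger2 -ge0_integralZl_EFin//.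
  - by move=> x _; rewrite lee_fin sqr_ge0.
  - apply/measurable_EFinP; apply: measurable_funX; apply: measurable_funB.
      have mkde : measurable_fun setT (kde K w n X).
        apply: measurable_funM => //; apply: measurable_sum => y.
        have mp : measurable_fun setT (fun x : R => (x, y)).
          exact: measurable_fun_pair.
        exact: (measurableT_comp mKw2 mp).
      exact: (measurableT_comp msq mkde).
    exact: mr.
rewrite -(@integral_iid_expect _ s ms s0 n _ _ leb h
  (fun z => Kw K w (z.1 - z.2)))//.
have msbar : measurable_fun setT sbar.
  have mg : measurable_fun setT (fun z : R * R => (s z.2 * Kw K w (z.1 - z.2))%:E).
    apply/measurable_EFinP; apply: measurable_funM => //.
    exact: (measurableT_comp ms m2).
  have mF := @measurable_fun_fubini_tonelli_F _ _ _ _ _ leb _ mg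
    (fun z => sKw0 z.1 z.2).
  apply/measurable_EFinP.
  rewrite (_ : EFin \o sbar = fubini_F leb
    (fun z : R * R => (s z.2 * Kw K w (z.1 - z.2))%:E))//.
  by apply/funext => x; rewrite /= -sbarE.
have mbias : measurable_fun setT
    (fun x : R => ((Num.sqrt (sbar x) - Num.sqrt (s x)) ^+ 2)%:E).
  apply/measurable_EFinP; apply: measurable_funX; apply: measurable_funB.
    exact: (measurableT_comp msq msbar).
  exact: mr.
apply: (@le_trans _ _ (\int[leb]_x (((Num.sqrt (sbar x) - Num.sqrt (s x)) ^+ 2)%:E
    + (n%:R^-1)%:E * (env x)%:E))%E).
  apply: ge0_le_integral_nomeas => x; first exact: iid_expect_ge0.
  rewrite -EFinM -EFinD (mulrC _ (env x)).
  (* The bound on the kernel is [env x], which depends on [x]; it holds wherever [s y != 0], since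
     such [y] lie in [[a, a + 2 * L]]. *)
  apply: (pointwise_risk ms s0 s1 (mKw x) (fun y => Kw0 (x - y)) (sbarE x)
    (env0 x)) => // y sy; apply: Kw_le_envelope => //.
  by apply: contrapT => /supp /eqP; rewrite (negbTE sy).
rewrite ge0_integralD//; last 3 first.
- by move=> x _; rewrite lee_fin sqr_ge0.
- by move=> x _; rewrite -EFinM lee_fin mulr_ge0// invr_ge0 ltW.
- under eq_fun do rewrite -EFinM.
  by apply/measurable_EFinP; exact: measurable_funM.
apply: leeD.
  apply: (bias_le mK K0 K1 ms s0 phi_nd phi_cc phi0 om w0) => x.
  by rewrite -integral_Kw_convolution.
rewrite ge0_integralZl_EFin//; last 2 first.
- by move=> x _; rewrite lee_fin.
- exact/measurable_EFinP.
rewrite [X in (_ <= X%:E)%E]mulrC EFinM lee_wpmul2l ?lee_fin ?invr_ge0 ?(ltW n0')//.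
have := integral_envelope mK K0 KM w0 AB L0 K1.
by rewrite (_ : a + 2 * L - a = 2 * L)//; ring.
Qed.

Theorem theorem2 (R : realType) (K : R -> R) (hK : kernel_ok K) :
  exists C : R, (unimodal K -> C = 1) /\
  forall (n : nat) (s : R -> R) (L : R) (phi : R -> R) (w : R),
    (0 < n)%N ->
    density s ->
    (exists a : R, forall x, ~ (a <= x <= a + 2 * L) -> s x = 0) ->
    {in [set x : R | 0 <= x] &, {homo phi : x y / x <= y}} ->
    (forall x y t, 0 <= x -> 0 <= y -> 0 <= t <= 1 ->
       t * phi x + (1 - t) * phi y <= phi (t * x + (1 - t) * y)) ->
    phi 0 = 0 ->
    (forall eta, 0 <= eta -> (omega2 (fun x => Num.sqrt (s x)) eta <= (phi eta)%:E)%E) ->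
    0 < w ->
    (iid_expect s n (fun X => hellinger2 (kde K w n X) s)
      <= 2%:E * (\int[@lebesgue_measure R]_x ((Num.max 1 (x ^+ 2)) * K x)%:E)
              * ((phi w) ^+ 2)%:E
         + (2 * L * sup (range K) / (n%:R * w))%:E
         + (C / n%:R)%:E)%E.
Proof.
have [A [B [AB uAB KA KB]]] := kernel_tails hK.
have [mK K0 K1 [M0 KM0] _] := hK.
have KM x : K x <= sup (range K).
  apply: ub_le_sup; last by exists x.
  by exists M0 => _ [y _ <-].
(* These are the terms of the envelope integral that do not involve [w] or [L]. *)
exists (sup (range K) * (B - A) + 1); split.
  by move=> /uAB ->; rewrite subrr mulr0 add0r.
move=> n s L phi w n0 ds [a supp] phi_nd phi_cc phi0 om w0.
have n0' : 0 < n%:R :> R by rewrite ltr0n.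
apply: le_trans (hellinger2_kde_le mK K0 K1 KM AB KA KB n0 ds supp phi_nd
  phi_cc phi0 om w0) _.
(* The variance terms agree exactly; the bias term has factor 1, bounded by 2 at the end. *)
rewrite -addeA -EFinD; apply: leeD; last first.
  rewrite lee_fin le_eqVlt; apply/orP; left; apply/eqP.
  by field; rewrite !gt_eqF.
rewrite lee_wpmul2r ?lee_fin ?sqr_ge0//.
have I0 : (0 <= \int[@lebesgue_measure R]_x (Num.max 1 (x ^+ 2) * K x)%:E)%E.
  by apply: integral_ge0 => x _; rewrite lee_fin mulr_ge0// le_max ler01.
by rewrite -[leLHS]mul1e lee_wpmul2r// lee_fin ler1n.
Qed.
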